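(* Let $R$ be a semi-potent ring. The following statements are equivalent: (1) $R$ is a $\Delta U$ ring, i.e. $U(R)=1+\Delta(R)$. (2) $R/J(R)$ is Boolean. (3) $R$ is a $UJ$ ring, i.e. $U(R)=1+J(R)$. (4) $R/J(R)$ is a $UU$ ring, i.e. every unit of $R/J(R)$ is the sum of $1$ and a nilpotent element.
   Context: Rings are associative with identity, not necessarily commutative. $U(R)$ is the group of units of $R$, $J(R)$ the Jacobson radical, $\mathrm{Nil}(R)$ the set of nilpotent elements. $\Delta(R)=\{r\in R : r+U(R)\subseteq U(R)\}$. A ring $R$ is $\Delta U$ if $U(R)=1+\Delta(R)$, $UJ$ if $U(R)=1+J(R)$, $UU$ if $U(R)=1+\mathrm{Nil}(R)$, and Boolean if every element is idempotent. $R$ is semi-potent if every one-sided ideal not contained in $J(R)$ contains a nonzero idempotent. *)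

(* Defs.v *)
From HB Require Import structures.
From mathcomp Require Import all_boot all_order all_algebra.
From mathcomp Require Import boolp classical_sets.

Set Implicit Arguments.
Unset Strict Implicit.
Unset Printing Implicit Defensive.

Import GRing.Theory.
Local Open Scope classical_set_scope.
Local Open Scope ring_scope.

(* The carrier structure is pzRingType throughout: associative rings with 1,
   possibly noncommutative, possibly zero.  No decision procedure for units is
   assumed (as unitRingType would), so units are defined propositionally. *)

Section RingSubsets.
Variable R : pzRingType.
Implicit Types I M K : set R.

Definition units : set R := [set u | exists v : R, u * v = 1 /\ v * u = 1].

Definition nilpotents : set R := [set x | exists n : nat, x ^+ n = 0].

Definition delta : set R := [set r | [set r + u | u in units] `<=` units].

Definition add_subgroup I :=
  [/\ I 0, (forall x y, I x -> I y -> I (x + y)) & forall x, I x -> I (- x)].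

Definition left_ideal I :=
  add_subgroup I /\ forall a x, I x -> I (a * x).

Definition right_ideal I :=
  add_subgroup I /\ forall a x, I x -> I (x * a).

Definition maximal_left_ideal M :=
  [/\ left_ideal M, M <> setT &
      forall K, left_ideal K -> M `<=` K -> K = M \/ K = setT].

(* The intersection of an empty family is setT, so J = R when R is zero. *)
Definition jacobson : set R := \bigcap_(M in maximal_left_ideal) M.

Definition is_idempotent (e : R) := e * e = e.

Definition boolean_ring := forall x : R, is_idempotent x.

Definition semipotent :=
  forall I, left_ideal I \/ right_ideal I -> ~ I `<=` jacobson ->
    exists e, [/\ I e, e <> 0 & is_idempotent e].

Definition deltaU_ring := units = [set 1 + d | d in delta].
Definition UJ_ring := units = [set 1 + j | j in jacobson].
Definition UU_ring := units = [set 1 + n | n in nilpotents].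

Lemma jacobson_add_subgroup : add_subgroup jacobson.
Proof.
split=> [M [[[]]] //|x y Jx Jy M maxM|x Jx M maxM].
  by case: (maxM) => -[[_ D _] _] _ _; apply: D; [apply: Jx|apply: Jy].
by case: (maxM) => -[[_ _ N] _] _ _; apply: N; apply: Jx.
Qed.

Lemma jacobson_left_ideal : left_ideal jacobson.
Proof.
split; first exact: jacobson_add_subgroup.
by move=> a x Jx M maxM; case: (maxM) => -[_ Ml] _ _; apply: Ml; apply: Jx.
Qed.

Lemma left_ideal_setT I : left_ideal I -> I 1 -> I = setT.
Proof.
by move=> [_ Il] I1; apply/seteqP; split=> // x _; rewrite -[x]mulr1; apply: Il.
Qed.

Lemma maximal_left_ideal_transporter M r :
  maximal_left_ideal M -> ~ M r -> maximal_left_ideal [set x | M (x * r)].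
Proof.
move=> [[[M0 MD MN] Ml] _ Mmax] nMr; split.
- split; first split=> [|x y|x] /=.
  + by rewrite mul0r.
  + by rewrite mulrDl; apply: MD.
  + by rewrite mulNr; apply: MN.
  by move=> a x /=; rewrite -mulrA; apply: Ml.
- by move=> T; apply: nMr; rewrite -[r]mul1r; have: setT (1 : R) by []; rewrite -T.
move=> K Kleft MK; have [[K0 KD KN] Kl] := Kleft.
case: (pselect (K `<=` [set x | M (x * r)])) => [KM|].
  by left; apply/seteqP; split.
move/existsNP => [n /not_implyP[Kn nMn]]; right; apply: left_ideal_setT => //.
pose L := [set y | exists m s, M m /\ y = m + s * (n * r)].
have LL : left_ideal L.
  split; first split.
  - by exists 0, 0; split=> //; rewrite mul0r addr0.
  - move=> _ _ [m [s [Mm ->]]] [m' [s' [Mm' ->]]].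
    by exists (m + m'), (s + s'); split; [apply: MD|rewrite mulrDl addrACA].
  - move=> _ [m [s [Mm ->]]].
    by exists (- m), (- s); split; [apply: MN|rewrite mulNr opprD].
  - move=> a _ [m [s [Mm ->]]].
    by exists (a * m), (a * s); split; [apply: Ml|rewrite mulrDr mulrA].
have ML : M `<=` L by move=> m Mm; exists m, 0; split=> //; rewrite mul0r addr0.
have [LM|LT] := Mmax L LL ML.
  by case: nMn; rewrite /= -LM; exists 0, 1; split=> //; rewrite mul1r add0r.
have [m [s [Mm rE]]] : L r by rewrite LT.
have K1s : K (1 - s * n).
  by apply: MK; rewrite /= mulrBl mul1r -mulrA [X in X - _]rE addrK.
by rewrite -[1](subrK (s * n)); apply: (KD _ _ K1s); apply: Kl.
Qed.

Lemma jacobson_right_ideal : right_ideal jacobson.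
Proof.
split; first exact: jacobson_add_subgroup.
move=> r x Jx M maxM; have [Mr|nMr] := pselect (M r).
  by case: maxM => -[_ Ml] _ _; apply: Ml.
exact: Jx (maximal_left_ideal_transporter maxM nMr).
Qed.

End RingSubsets.

Arguments units : clear implicits.
Arguments nilpotents : clear implicits.
Arguments delta : clear implicits.
Arguments jacobson : clear implicits.
Arguments boolean_ring : clear implicits.
Arguments semipotent : clear implicits.
Arguments deltaU_ring : clear implicits.
Arguments UJ_ring : clear implicits.
Arguments UU_ring : clear implicits.

(* MathComp only provides ring quotients in the commutative case, so the ring
   structure is put here on its additive quotient of R by J(R). *)
Section JacobsonQuotient.
Variable R : pzRingType.

Definition jacobson_pred (x : R) : bool := `[< jacobson R x >].

Lemma jacobson_pred_zmod_closed : zmod_closed jacobson_pred.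
Proof.
have [J0 JD JN] := jacobson_add_subgroup R.
split; first exact/asboolP.
by move=> x y /asboolP Jx /asboolP Jy; apply/asboolP; apply: JD => //; apply: JN.
Qed.

HB.instance Definition _ :=
  GRing.isZmodClosed.Build R jacobson_pred jacobson_pred_zmod_closed.

Definition jacobson_zmodClosed := GRing.ZmodClosed.clone R jacobson_pred _.

Definition jacobson_quot : Type := Quotient.quot jacobson_zmodClosed.

HB.instance Definition _ := GRing.Zmodule.on jacobson_quot.
HB.instance Definition _ := Quotient.on jacobson_quot.

Local Notation Q := jacobson_quot.
Local Notation pi := (\pi_Q)%qT.

Lemma jacobson_quot_eq (x y : R) : pi x = pi y <-> jacobson R (x - y).
Proof.
have E := Quotient.idealrBE jacobson_zmodClosed x y.
split=> [xy|Jxy]; last by apply/eqP; rewrite -E; apply/asboolP.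
by apply/asboolP; change (is_true (x - y \in jacobson_pred)); rewrite E; apply/eqP.
Qed.

Definition jq_one : Q := pi 1.
Definition jq_mul (a b : Q) : Q := pi (repr a * repr b).

Lemma jq_mulE x y : jq_mul (pi x) (pi y) = pi (x * y).
Proof.
have [_ JD _] := jacobson_add_subgroup R.
have [_ Jl] := jacobson_left_ideal R.
have [_ Jr] := jacobson_right_ideal R.
apply/jacobson_quot_eq.
set x' := repr _; set y' := repr _.
have Jx : jacobson R (x' - x) by apply/jacobson_quot_eq; rewrite reprK.
have Jy : jacobson R (y' - y) by apply/jacobson_quot_eq; rewrite reprK.
have -> : x' * y' - x * y = x' * (y' - y) + (x' - x) * y.
  by rewrite mulrBr mulrBl addrA subrK.
by apply: JD; [apply: Jl|apply: Jr].
Qed.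

Lemma jq_addE x y : pi x + pi y = pi (x + y) :> Q.
Proof. by symmetry; exact: Quotient.pi_add. Qed.

Lemma jq_surj (a : Q) : exists x, a = pi x.
Proof. by exists (repr a); rewrite reprK. Qed.

Fact jq_mulA : associative jq_mul.
Proof.
move=> a b c; have [[x ->] [y ->] [z ->]] := And3 (jq_surj a) (jq_surj b) (jq_surj c).
by rewrite !jq_mulE mulrA.
Qed.

Fact jq_mul1l : left_id jq_one jq_mul.
Proof. by move=> a; have [x ->] := jq_surj a; rewrite jq_mulE mul1r. Qed.

Fact jq_mul1r : right_id jq_one jq_mul.
Proof. by move=> a; have [x ->] := jq_surj a; rewrite jq_mulE mulr1. Qed.

Fact jq_mulDl : left_distributive jq_mul +%R.
Proof.
move=> a b c; have [[x ->] [y ->] [z ->]] := And3 (jq_surj a) (jq_surj b) (jq_surj c).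
by rewrite jq_addE !jq_mulE jq_addE mulrDl.
Qed.

Fact jq_mulDr : right_distributive jq_mul +%R.
Proof.
move=> a b c; have [[x ->] [y ->] [z ->]] := And3 (jq_surj a) (jq_surj b) (jq_surj c).
by rewrite jq_addE !jq_mulE jq_addE mulrDr.
Qed.

HB.instance Definition _ := GRing.Zmodule_isPzRing.Build jacobson_quot
  jq_mulA jq_mul1l jq_mul1r jq_mulDl jq_mulDr.

Definition jacobson_proj (x : R) : jacobson_quot := pi x.

Fact jacobson_proj_zmod_morphism : zmod_morphism jacobson_proj.
Proof.
move=> x y; apply: (addIr (jacobson_proj y)).
by rewrite [LHS]jq_addE !subrK.
Qed.

Fact jacobson_proj_monoid_morphism : monoid_morphism jacobson_proj.
Proof. by split=> // x y; rewrite [RHS]jq_mulE. Qed.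

HB.instance Definition _ := GRing.isZmodMorphism.Build R jacobson_quot
  jacobson_proj jacobson_proj_zmod_morphism.
HB.instance Definition _ := GRing.isMonoidMorphism.Build R jacobson_quot
  jacobson_proj jacobson_proj_monoid_morphism.

Lemma jacobson_proj_surj (a : jacobson_quot) : exists x, a = jacobson_proj x.
Proof. exact: jq_surj. Qed.

Lemma jacobson_proj_eq0 (x : R) : jacobson_proj x = 0 <-> jacobson R x.
Proof.
by rewrite -(rmorph0 jacobson_proj); split=> [/jacobson_quot_eq|Jx];
  [|apply/jacobson_quot_eq]; rewrite subr0.
Qed.

End JacobsonQuotient.

(* Main.v *)
(* A corner gRg is called exceptional here when it contains a unit w such that
   g + w is again a unit.  If u - 1 is in Delta or nilpotent for every unit u,
   then no corner with g <> 0 is exceptional: 1 + w extends to a unit of R, so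
   w would be both invertible in gRg and in Delta (or nilpotent).  Conversely,
   let S = R/J(R), in which every nonzero principal right ideal contains a
   nonzero idempotent.  A nonzero x with x^2 = 0 yields 2 x 2 matrix units,
   and [[0,1],[1,-1]] makes that corner exceptional; hence S is reduced and its
   idempotents are central.  A nonzero x^2 - x then yields a central idempotent
   e = (x^2 - x) y <> 0, and w = e (x - 1) makes eS exceptional; hence S is
   Boolean.  The remaining implications lift units along R -> R/J(R). *)

Require Import Defs.
From mathcomp Require Import all_boot all_algebra.
From mathcomp Require Import boolp classical_sets.

Section JacobsonUnits.
Local Open Scope classical_set_scope.
Local Open Scope ring_scope.
Import GRing.Theory.
Set Implicit Arguments.
Unset Strict Implicit.
Unset Printing Implicit Defensive.

Variable R : pzRingType.
Implicit Types (x y u v j : R) (L : set R).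

(** * Maximal left ideals and units modulo the radical *)

Lemma exists_maximal_left_ideal L :
  left_ideal L -> ~ L 1 -> exists2 M, maximal_left_ideal M & L `<=` M.
Proof.
move=> LL L1.
(* Adjoining L lets the empty chain have an upper bound. *)
pose P (K : set R) := left_ideal (L `|` K) /\ ~ (L `|` K) 1.
have [F FP Ftot|A [[LA A1] Amax]] := @Zorn_bigcup R P.
  have chain x y : (L `|` \bigcup_(X in F) X) x ->
      (L `|` \bigcup_(X in F) X) y ->
      exists K, [/\ left_ideal (L `|` K), (L `|` K) x, (L `|` K) y &
        L `|` K `<=` L `|` \bigcup_(X in F) X].
    have sub X : F X -> L `|` X `<=` L `|` \bigcup_(X in F) X.
      by move=> FX z [Lz|Xz]; [left|right; exists X].
    case=> [Lx|[X FX Xx]] [Ly|[Y FY Yy]].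
    - by exists set0; split; rewrite ?setU0 // => z; left.
    - by exists Y; split; [case: (FP _ FY)|left|right|exact: sub].
    - by exists X; split; [case: (FP _ FX)|right|left|exact: sub].
    - have [XY|YX] := Ftot _ _ FX FY.
      + by exists Y; split; [case: (FP _ FY)|right; exact: XY|right|exact: sub].
      + by exists X; split; [case: (FP _ FX)|right|right; exact: YX|exact: sub].
  split; last first.
    by case=> [//|[X FX X1]]; case: (FP _ FX) => _; apply; right.
  split; first split.
  - by left; case: LL => -[].
  - move=> x y Ux Uy; have [K [[[_ D _] _] Kx Ky sub]] := chain _ _ Ux Uy.
    by apply: sub; apply: D.
  - move=> x Ux; have [K [[[_ _ N] _] Kx _ sub]] := chain _ _ Ux Ux.
    by apply: sub; apply: N.
  - move=> a x Ux; have [K [[_ Kl] Kx _ sub]] := chain _ _ Ux Ux.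
    by apply: sub; apply: Kl.
exists (L `|` A); last by move=> z; left.
split=> // [T|K LK sub]; first by apply: A1; rewrite T.
have LKE : L `|` K = K.
  by apply/seteqP; split=> z; [case=> // Lz; apply: sub; left|right].
have [K1|K1] := pselect (K 1); first by right; apply: left_ideal_setT.
left; apply/seteqP; split=> //.
have PK : P K by split; rewrite LKE.
apply: contrapT => KA; apply: (Amax K) PK; split.
  by move=> z Az; apply: sub; right.
by move=> KA'; apply: KA => z /KA' Az; right.
Qed.

(** Otherwise [R(1 + j)] lies in a maximal left ideal, which also contains [j] and hence 1. *)
Lemma jacobson_left_inverse j : jacobson R j -> exists v, v * (1 + j) = 1.
Proof.
move=> Jj; pose L := [set x | exists a, x = a * (1 + j)].
have LL : left_ideal L.
  split; [split|].
  - by exists 0; rewrite mul0r.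
  - by move=> _ _ [a ->] [b ->]; exists (a + b); rewrite mulrDl.
  - by move=> _ [a ->]; exists (- a); rewrite mulNr.
  - by move=> b _ [a ->]; exists (b * a); rewrite mulrA.
have [[v /esym vj]|L1] := pselect (L 1); first by exists v.
have [M maxM LM] := exists_maximal_left_ideal LL L1.
have Mj := Jj _ maxM; case: maxM => idM MT _; have [[_ D N] _] := idM.
case: MT; apply: left_ideal_setT => //.
rewrite -[1](addrK j); apply: D; last exact: N.
by apply: LM; exists 1; rewrite mul1r.
Qed.

(** The left inverse [v = 1 - v j] is again in 1 + J, so it has its own left inverse, which must
    coincide with its right inverse [1 + j]. *)
Lemma jacobson_unit j : jacobson R j -> units R (1 + j).
Proof.
move=> Jj; have [v vj] := jacobson_left_inverse Jj.
have [_ Jl] := jacobson_left_ideal R.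
have Jvj : jacobson R (- v * j) by apply: Jl.
have vE : v = 1 + - v * j by rewrite -vj mulrDr mulr1 mulNr addrK.
have [t] := jacobson_left_inverse Jvj; rewrite -vE => tv.
have tE : t = 1 + j by rewrite -[t]mulr1 -{1}vj mulrA tv mul1r.
by exists v; rewrite -tE; split=> //; rewrite tE.
Qed.

Lemma units1 : units R 1.
Proof. by exists 1; rewrite mulr1. Qed.

Lemma unitsM u v : units R u -> units R v -> units R (u * v).
Proof.
move=> [u' [uu' u'u]] [v' [vv' v'v]]; exists (v' * u'); split.
  by rewrite mulrA -(mulrA u) vv' mulr1.
by rewrite mulrA -(mulrA v') u'u mulr1.
Qed.

Lemma one_sided_units u x y : units R (u * x) -> units R (y * u) -> units R u.
Proof.
move=> [a [ua _]] [b [_ bu]]; exists (x * a); split; first by rewrite mulrA.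
suff -> : x * a = b * y by rewrite -mulrA.
by rewrite -[x * a]mul1r -bu -!mulrA (mulrA u) ua mulr1.
Qed.

Lemma unit_add_jacobson u j : units R u -> jacobson R j -> units R (u + j).
Proof.
move=> Uu Jj; have [v [uv _]] := Uu.
have -> : u + j = u * (1 + v * j) by rewrite mulrDr mulr1 mulrA uv mul1r.
apply: unitsM => //; apply: jacobson_unit.
by have [_ Jl] := jacobson_left_ideal R; apply: Jl.
Qed.

Lemma jacobson_sub_delta : jacobson R `<=` delta R.
Proof. by move=> j Jj _ [u Uu <-]; rewrite addrC; apply: unit_add_jacobson. Qed.

Lemma unit_idempotent u : units R u -> is_idempotent u -> u = 1.
Proof. by move=> [v [uv _]] uu; rewrite -[u]mulr1 -{1}uv mulrA uu. Qed.

Lemma idempotentC e : is_idempotent e -> is_idempotent (1 - e : R).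
Proof.
by move=> ee; rewrite /is_idempotent mulrBr mulr1 mulrBl mul1r ee subrr subr0.
Qed.

Lemma jacobson_idempotent e : jacobson R e -> is_idempotent e -> e = 0.
Proof.
move=> Je ee; have [_ _ JN] := jacobson_add_subgroup R.
have /unit_idempotent E := jacobson_unit (JN _ Je).
by apply: oppr_inj; apply: (addrI 1); rewrite E ?oppr0 ?addr0 //;
  exact: idempotentC.
Qed.

Lemma nilpotent_unit x : nilpotents R x -> units R (1 + x).
Proof.
move=> [n xn].
have cX : (- x) ^+ n = 0 by rewrite exprNn xn mulr0.
(* The inverse is the finite geometric series in [- x]. *)
pose s := \sum_(i < n) (- x) ^+ i.
have E : (1 + x) * s = 1.
  by rewrite -[LHS]opprK -mulNr opprD addrC -subrX1 cX sub0r opprK.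
exists s; split=> //; rewrite -[RHS]E /s mulr_suml mulr_sumr.
apply: eq_bigr => i _; apply/esym/commrX.
by rewrite /GRing.comm mulrDl mulrDr mul1r mulr1 mulrN mulNr.
Qed.

(** * Units of corner rings gRg *)

Definition corner_unit (g w : R) :=
  exists z, [/\ [/\ g * w = w, w * g = w, g * z = z & z * g = z],
               w * z = g & z * w = g].

Lemma corner_unit_idem g w : corner_unit g w -> is_idempotent g.
Proof.
by move=> [z [[gw _ _ _] wz _]]; rewrite /is_idempotent -{2}wz mulrA gw.
Qed.

Lemma corner_unitN g w : corner_unit g w -> corner_unit g (- w).
Proof.
move=> [z [[gw wg gz zg] wz zw]]; exists (- z).
by rewrite !mulrN !mulNr !opprK gw wg gz zg.
Qed.

(** The corners of [g] and [1 - g] annihilate each other, so [1 - g + z] is the inverse. *)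
Lemma corner_unit_extend g w : corner_unit g w -> units R (1 - g + w).
Proof.
move=> cw; have gg := corner_unit_idem cw.
case: cw => z [[gw wg gz zg] wz zw].
exists (1 - g + z).
have C t : g * t = t -> (1 - g) * t = 0.
  by move=> gt; rewrite mulrBl mul1r gt subrr.
have C' t : t * g = t -> t * (1 - g) = 0.
  by move=> gt; rewrite mulrBr mulr1 gt subrr.
split; rewrite mulrDl (mulrDr (1 - g)) idempotentC // C //
  addr0 mulrDr C' // add0r.
  by rewrite wz subrK.
by rewrite zw subrK.
Qed.

(** Adding [w] to the unit [1 - g - w] shows that the idempotent [1 - g] is a unit, hence 1. *)
Lemma corner_unit_delta g w : corner_unit g w -> delta R w -> g = 0.
Proof.
move=> cw dw; have gg := corner_unit_idem cw.
have /unit_idempotent E : units R (1 - g).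
  apply: dw; exists (1 - g - w); last by rewrite addrC subrK.
  by apply: corner_unit_extend; apply: corner_unitN.
by rewrite -[g](subKr 1) E ?subrr //; exact: idempotentC.
Qed.

Lemma corner_unit_nilpotent g w : corner_unit g w -> nilpotents R w -> g = 0.
Proof.
move=> cw [n wn]; have gg := corner_unit_idem cw.
case: cw => z [[gw _ _ _] _ zw].
(* Left multiplication by [w] is injective on gR, and so are its powers. *)
have K t : g * t = t -> w ^+ n * t = 0 -> t = 0.
  elim: n t {wn} => [|n IH] t gt; first by rewrite expr0 mul1r.
  rewrite exprSr -mulrA => /IH wt0.
  by rewrite -gt -zw -mulrA wt0 ?mulr0 // mulrA gw.
by apply: K => //; rewrite wn mul0r.
Qed.

Definition no_exceptional_corner :=
  forall g w, corner_unit g w -> corner_unit g (g + w) -> g = 0.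

(** Extending the corner unit [g + w] gives the unit [1 - g + (g + w) = 1 + w], so [w] lies in
    [P]. *)
Lemma no_exceptional_corner_units (P : set R) :
  units R `<=` [set 1 + d | d in P] ->
  (forall g w, corner_unit g w -> P w -> g = 0) ->
  no_exceptional_corner.
Proof.
move=> UP PC g w cw /corner_unit_extend; rewrite addrA subrK => /UP[d Pd].
by move=> /addrI dw; apply: (PC _ _ cw); rewrite -dw.
Qed.

(** The form in which semi-potency passes to R/J(R): only the right ideals xR are tested. *)
Definition principal_semipotent :=
  forall x, x <> 0 -> exists y, is_idempotent (x * y) /\ x * y <> 0.

(** * From reduced to Boolean, for a ring in the role of R/J(R) *)

Hypotheses (noexc : no_exceptional_corner) (semip : principal_semipotent).

Lemma square_zero_eq0 x : x * x = 0 -> x = 0.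
Proof.
move=> xx; apply: contrapT => /semip[y []]; move exy: (x * y) => e ee e0.
have xe : x * e = 0 by rewrite -exy mulrA xx mul0r.
(* [e = a b] and [f = b a] are orthogonal, so e, a, b, f are matrix units. *)
pose a := e * x; pose b := (1 - e) * (y * e); pose f := b * a.
have ea : e * a = a by rewrite mulrA ee.
have ae : a * e = 0 by rewrite -mulrA xe mulr0.
have eb : e * b = 0 by rewrite /b mulrA mulrBr mulr1 ee subrr mul0r.
have be : b * e = b by rewrite /b -!mulrA ee.
have ab : a * b = e.
  by rewrite mulrA mulrBr mulr1 ae subr0 /a -mulrA (mulrA x) exy !ee.
have aa : a * a = 0 by rewrite -{2}ea mulrA ae mul0r.
have bb : b * b = 0 by rewrite -{1}be -mulrA eb mulr0.
have ef : e * f = 0 by rewrite mulrA eb mul0r.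
have fe : f * e = 0 by rewrite -mulrA ae mulr0.
have af : a * f = a by rewrite mulrA ab ea.
have fa : f * a = 0 by rewrite -mulrA aa mulr0.
have fb : f * b = b by rewrite -mulrA ab be.
have bf : b * f = 0 by rewrite mulrA bb mul0r.
have ff : f * f = f by rewrite -mulrA af.
(* [w] is the matrix [[0,1],[1,-1]]; since [w * w = g - w], the elements [w] and [g + w] are
   mutually inverse in gRg. *)
pose g := e + f; pose w := a + b - f.
have ge : g * e = e by rewrite mulrDl ee fe addr0.
have gg : g * g = g by rewrite mulrDl !mulrDr ee ef fe ff addr0 add0r.
have gw : g * w = w.
  by rewrite mulrDl !mulrBr !mulrDr ea eb ef fa fb ff addr0 subr0 add0r addrA.
have wg : w * g = w.
  by rewrite mulrDr !mulrBl !mulrDl ae be fe af bf ff subr0 add0r addr0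
    addrCA addrA.
have ww : w * w = g - w.
  have -> : w * w = e - a + f - (b - f).
    by rewrite {1}/w mulrBl mulrDl !mulrBr !mulrDr aa ab af bb bf fa fb ff
      add0r addr0 subr0 add0r.
  by rewrite !opprB opprD (addrAC e) -!addrA;
    congr (_ + (_ + _)); rewrite addrCA.
have c1 : w * (g + w) = g by rewrite mulrDr wg ww addrCA subrr addr0.
have c2 : (g + w) * w = g by rewrite mulrDl gw ww addrCA subrr addr0.
have g1 : g * (g + w) = g + w by rewrite mulrDr gg gw.
have g2 : (g + w) * g = g + w by rewrite mulrDl gg wg.
have g0 : g = 0.
  by apply: (noexc (w := w)); [exists (g + w)|exists w].
by apply: e0; rewrite -ge g0 mul0r.
Qed.

(** Both [e x (1 - e)] and [(1 - e) x e] square to zero, hence vanish. *)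
Lemma idempotent_central e x : is_idempotent e -> e * x = x * e.
Proof.
move=> ee; have eC : e * (1 - e) = 0 by rewrite mulrBr mulr1 ee subrr.
have Ce : (1 - e) * e = 0 by rewrite mulrBl mul1r ee subrr.
have /eqP : e * x * (1 - e) = 0.
  by apply: square_zero_eq0; rewrite -!mulrA (mulrA (1 - e) e) Ce mul0r !mulr0.
have /eqP : (1 - e) * x * e = 0.
  by apply: square_zero_eq0; rewrite -!mulrA (mulrA e (1 - e)) eC mul0r !mulr0.
rewrite !mulrBl mul1r mulrBr mulr1 !subr_eq0.
by move=> /eqP -> /eqP.
Qed.

Lemma corner_unit_factor x y :
  is_idempotent (x * y) -> corner_unit (x * y) (x * y * x).
Proof.
move exy: (x * y) => e ee.
have cen z : e * z = z * e by apply: idempotent_central.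
(* This is the left inverse law for [y * e]. The idempotent [g = y e x] is central, so
   [e = x g y = g (x y) = g e = g]. *)
have gE : y * e * x = e.
  move gdef: (y * e * x) => g.
  have gg : is_idempotent g.
    by rewrite /is_idempotent -gdef -!mulrA (mulrA x y) exy
      (mulrA e e) ee (mulrA e e) ee.
  have eg : e * g = g by rewrite -gdef !mulrA cen -!mulrA (mulrA e e) ee.
  have : x * g * y = e by rewrite -gdef !mulrA exy ee -mulrA exy ee.
  by rewrite -(idempotent_central x gg) -mulrA exy -cen eg.
exists (y * e); split; [split| |].
- by rewrite mulrA ee.
- by rewrite -mulrA -cen mulrA ee.
- by rewrite cen -mulrA ee.
- by rewrite -mulrA ee.
- by rewrite -mulrA (mulrA x) exy !ee.
- by rewrite mulrA -(mulrA y) ee.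
Qed.

Lemma semipotent_boolean : boolean_ring R.
Proof.
move=> x; apply: contrapT => xx.
have /semip[y []] : x * (x - 1) <> 0.
  by rewrite mulrBr mulr1 => /eqP; rewrite subr_eq0 => /eqP.
move edef: (_ * y) => e ee; apply.
(* Since [x] and [x - 1] commute, [e] factors through either one, so [e x] and [e (x - 1)] are
   corner units; they differ by [e]. *)
have e1 : e = x * ((x - 1) * y) by rewrite mulrA.
have e2 : e = (x - 1) * (x * y).
  by rewrite -edef mulrA mulrBr mulrBl mulr1 mul1r.
have c1 : corner_unit e (e * x).
  by rewrite e1; apply: corner_unit_factor; rewrite -e1.
have c2 : corner_unit e (e * (x - 1)).
  by rewrite e2; apply: corner_unit_factor; rewrite -e2.
by apply: (noexc c2); rewrite mulrBr mulr1 addrC subrK.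
Qed.

End JacobsonUnits.

(** * Transfer between R and R/J(R) *)

Section JacobsonQuotientUnits.
Local Open Scope classical_set_scope.
Local Open Scope ring_scope.
Import GRing.Theory.

Variable R : pzRingType.
Local Notation pi := (@jacobson_proj R).

Lemma jacobson_proj_eq (x y : R) : pi x = pi y -> jacobson R (x - y).
Proof. by move=> E; apply/jacobson_proj_eq0; rewrite rmorphB /= E subrr. Qed.

(** If [y] lifts the inverse of [pi x], then [x y] and [y x] lie in 1 + J and are units. *)
Lemma jacobson_proj_unit (x : R) : units (jacobson_quot R) (pi x) <-> units R x.
Proof.
split=> [[v]|[v [xv vx]]]; last first.
  by exists (pi v); rewrite -!rmorphM xv vx rmorph1.
have [y ->] := jacobson_proj_surj v; rewrite -!rmorphM -(rmorph1 pi).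
move=> [/jacobson_proj_eq xy /jacobson_proj_eq yx].
have lift z : jacobson R (z - 1) -> units R z.
  by move=> /jacobson_unit; rewrite addrC subrK.
exact: one_sided_units (lift _ xy) (lift _ yx).
Qed.

Lemma jacobson_quot_principal_semipotent :
  semipotent R -> principal_semipotent (jacobson_quot R).
Proof.
move=> sR a; have [x ->] := jacobson_proj_surj a => x0.
pose I := [set z | exists y, z = x * y].
have rI : right_ideal I.
  split; first split.
  - by exists 0; rewrite mulr0.
  - by move=> _ _ [y ->] [z ->]; exists (y + z); rewrite mulrDr.
  - by move=> _ [y ->]; exists (- y); rewrite mulrN.
  - by move=> b _ [y ->]; exists (y * b); rewrite mulrA.
have [|_ [[y ->] e0 ee]] := sR I (or_intror rI).
  by move=> IJ; apply: x0; apply/jacobson_proj_eq0; apply: IJ; exists 1;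
    rewrite mulr1.
exists (pi y); rewrite -rmorphM; split.
  by rewrite /is_idempotent -rmorphM ee.
(* The idempotent survives in the quotient because J(R) contains no nonzero idempotent. *)
by move/jacobson_proj_eq0 => /jacobson_idempotent /(_ ee).
Qed.

Lemma deltaU_quot :
  deltaU_ring R ->
  units (jacobson_quot R) `<=` [set 1 + d | d in delta (jacobson_quot R)].
Proof.
move=> dU a; have [u ->] := jacobson_proj_surj a => /jacobson_proj_unit.
rewrite dU => -[d dd <-]; exists (pi d); last by rewrite rmorphD rmorph1.
move=> _ [b Ub <-]; have [v vE] := jacobson_proj_surj b.
move: Ub; rewrite vE -rmorphD => /jacobson_proj_unit Uv.
by apply/jacobson_proj_unit; apply: dd; exists v.
Qed.

Lemma boolean_UJ : boolean_ring (jacobson_quot R) -> UJ_ring R.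
Proof.
move=> B; apply/seteqP; split=> [u Uu|_ [j Jj <-]]; last exact: jacobson_unit.
exists (u - 1); last by rewrite addrC subrK.
(* In a Boolean ring the only unit is 1. *)
apply: jacobson_proj_eq; rewrite rmorph1; apply: unit_idempotent (B _).
exact/jacobson_proj_unit.
Qed.

Lemma UJ_quot_UU : UJ_ring R -> UU_ring (jacobson_quot R).
Proof.
move=> UJ; apply/seteqP; split=> [a|_ [n Nn <-]]; last exact: nilpotent_unit.
have [u ->] := jacobson_proj_surj a => /jacobson_proj_unit.
rewrite UJ => -[j /jacobson_proj_eq0 j0 <-].
by exists 0; [exists 1%N; rewrite expr1|rewrite rmorphD rmorph1 /= j0].
Qed.

Lemma UJ_deltaU : UJ_ring R -> deltaU_ring R.
Proof.
move=> UJ; apply/seteqP; split=> [u|_ [d dd <-]].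
  by rewrite UJ => -[j Jj <-]; exists j => //; exact: jacobson_sub_delta.
by rewrite addrC; apply: dd; exists 1 => //; exact: units1.
Qed.

End JacobsonQuotientUnits.

Theorem theorem2p5 (R : pzRingType) (hR : semipotent R) :
  [<-> deltaU_ring R;
       boolean_ring (jacobson_quot R);
       UJ_ring R;
       UU_ring (jacobson_quot R)].
Proof.
have sQ := jacobson_quot_principal_semipotent hR.
tfae.
- move=> /deltaU_quot dU; apply: semipotent_boolean sQ.
  exact: no_exceptional_corner_units dU (@corner_unit_delta _).
- exact: boolean_UJ.
- exact: UJ_quot_UU.
(* The cycle closes by going back through Boolean and UJ, with nilpotents in place of Delta. *)
- move=> UU; apply/UJ_deltaU/boolean_UJ/semipotent_boolean => //.
  apply: (@no_exceptional_corner_units _ (nilpotents _)); first by rewrite UU.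
  exact: corner_unit_nilpotent.
Qed.
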